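(* Let $A$ be a symmetric $n\times n$ tropical matrix of symmetric tropical rank $2$. Then $A$ has symmetric Barvinok rank $2$ if and only if its symbic tree is a caterpillar tree with only one fixed point.
   Context: The tropical semiring is $(\mathbb{R},\oplus,\odot)$ with $x\oplus y=\min(x,y)$, $x\odot y=x+y$. The symmetric Barvinok rank of a symmetric matrix $A\in\mathbb{R}^{n\times n}$ is the smallest $r$ such that $A=B\odot B^\top$ (tropical matrix product) for some $B\in\mathbb{R}^{n\times r}$. A $k\times k$ tropical matrix $(a_{ij})$ is tropically singular if $\min_{\sigma\in S_k}(a_{1\sigma(1)}+\dots+a_{k\sigma(k)})$ is attained by at least two permutations; it is tropically nonsingular otherwise. The tropical rank of a matrix is the size of its largest tropically nonsingular square submatrix. A symmetric $k\times k$ tropical matrix is tropically symmetrically singular if this minimum is attained at two distinct monomials in the variables $a_{ij}$, $i\le j$, after identifying $a_{ij}$ and $a_{ji}$. The symmetric tropical rank of a symmetric matrix is the size of its largest nonsingular square submatrix, where ''singular'' means tropically symmetrically singular for principal submatrices and tropically singular for non-principal ones. Bicolored trees: a bicolored tree with $d$ red and $n$ blue leaves is a tree with these (labeled, colored) leaves such that removing any internal edge partitions the leaves into two parts each containing both colors. To a $d\times n$ tropical matrix $A$ of tropical rank $2$ one associates a bicolored metric tree as follows. The tropical convex hull of the columns of $A$ in $\mathbb{R}^d/\mathbb{R}(1,\dots,1)$ is a contractible one-dimensional polyhedral complex (a tree). It can be made balanced, hence into a tropical line, by attaching one infinite ray in each coordinate direction $e_1,\dots,e_d$ in a unique way. Attach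 a blue leaf labeled $i$ at the position of the $i$-th column of $A$, and a red leaf labeled $j$ at the point where the infinite ray in direction $e_j$ is attached. Each internal edge has as length its length under the tropical Hilbert metric $d(x,y)=\max_i(x_i-y_i)-\min_i(x_i-y_i)$; leaf edges have no length (or length $\infty$). Symbic trees: a symmetric bicolored tree, or symbic tree, is a bicolored tree on $n$ red and $n$ blue leaves (each color labeled $1,\dots,n$) that is invariant under swapping the colors (red leaf $i\leftrightarrow$ blue leaf $i$), and such that color-swapping the leaves induces an automorphism of the whole tree whose fixed points form a path (possibly a single point). It is known that the bicolored tree of a symmetric matrix of symmetric tropical rank $2$ is symbic; it is called the symbic tree of the matrix. ''Fixed point'' means a point of the tree fixed by the color-swapping automorphism. A tree is a caterpillar if all its internal vertices lie along a path. *)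

(* Defs.v *)
From mathcomp Require Import all_boot all_order perm all_algebra.
From mathcomp Require Import boolp reals.

Set Implicit Arguments.
Unset Strict Implicit.
Unset Printing Implicit Defensive.

Import Order.TTheory GRing.Theory Num.Theory.

Local Open Scope ring_scope.

Section TropicalMatrices.
Variable R : realType.

Definition is_min (I : Type) (f : I -> R) (m : R) : Prop :=
  (exists i, f i = m) /\ (forall i, m <= f i).

(* "A = B (.) C" in the min-plus semiring.  It is a relation rather than an
   operation because an empty minimum (inner dimension 0) is not a real. *)
Definition is_tmulmx m k p (B : 'M[R]_(m, k)) (C : 'M[R]_(k, p))
    (A : 'M[R]_(m, p)) : Prop :=
  forall i j, is_min (fun l : 'I_k => B i l + C l j) (A i j).

Definition sym_factors n (A : 'M[R]_n) (r : nat) : Prop :=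
  exists B : 'M[R]_(n, r), is_tmulmx B B^T A.

(* A relation, since a symmetric matrix may have no factorization at all. *)
Definition is_sym_barvinok_rank n (A : 'M[R]_n) (r : nat) : Prop :=
  sym_factors A r /\ forall s, sym_factors A s -> (r <= s)%N.

Definition tweight k (M : 'M[R]_k) (s : 'S_k) : R := \sum_i M i (s i).

Definition tminimal k (M : 'M[R]_k) (s : 'S_k) : bool :=
  [forall t : 'S_k, tweight M s <= tweight M t].

Definition tsingular k (M : 'M[R]_k) : bool :=
  [exists s : 'S_k, exists t : 'S_k, [&& s != t, tminimal M s & tminimal M t]].

(* Exponent vector of prod_l a_(l, s l) in the variables a_(i, j), i <= j. *)
Definition sym_monomial k (s : 'S_k) : {ffun 'I_k * 'I_k -> nat} :=
  [ffun ij => #|[set l : 'I_k | (if (l <= s l)%N then (l, s l) else (s l, l)) == ij]|].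

Definition tsym_singular k (M : 'M[R]_k) : bool :=
  [exists s : 'S_k, exists t : 'S_k,
    [&& sym_monomial s != sym_monomial t, tminimal M s & tminimal M t]].

Definition increasing k n (f : {ffun 'I_k -> 'I_n}) : bool :=
  [forall i : 'I_k, forall j : 'I_k, (i < j)%N ==> (f i < f j)%N].

(* The submatrix with rows [f] and columns [g] is principal iff [f == g], as
   both are increasing. *)
Definition has_sym_nonsingular_sub n (A : 'M[R]_n) (k : nat) : bool :=
  [exists f : {ffun 'I_k -> 'I_n}, exists g : {ffun 'I_k -> 'I_n},
    [&& increasing f, increasing g &
      if f == g then ~~ tsym_singular (mxsub f g A)
      else ~~ tsingular (mxsub f g A)]].

Definition sym_tropical_rank n (A : 'M[R]_n) : nat :=
  \max_(k < n.+1 | has_sym_nonsingular_sub A k) k.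

End TropicalMatrices.

(* Points of R^d / R(1,...,1) are represented by column vectors; equality in the
   quotient is [tequiv], and subsets of the quotient are [tequiv]-saturated. *)
Section TropicalPoints.
Variables (R : realType) (d : nat).
Implicit Types (x y p : 'cV[R]_d) (S : {set 'I_d}) (H : 'cV[R]_d -> Prop).

Definition tequiv x y : Prop := exists c : R, y = x + const_mx c.

(* max_i (x_i - y_i) - min_j (x_j - y_j), as a maximum over pairs (i, j); the
   default value 0 is harmless because it is attained at i = j. *)
Definition hilbert x y : R :=
  \big[Num.max/0]_(i < d) \big[Num.max/0]_(j < d)
    ((x i 0 - y i 0) - (x j 0 - y j 0)).

Definition tconv n (A : 'M[R]_(d, n)) x : Prop :=
  exists c : 'cV[R]_n, is_tmulmx A c x.

Definition ind S : 'cV[R]_d := \col_i (i \in S)%:R.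

(* The edges leaving [p] inside the one-dimensional complex [H].  Every edge of
   a tropical convex hull has as primitive direction a 0/1 vector [ind S];
   [ind set0] and [ind setT] vanish modulo (1,...,1). *)
Definition germs H p : {set {set 'I_d}} :=
  [set S : {set 'I_d} | [&& S != set0, S != setT &
    `[< exists2 e : R, 0 < e &
          forall t : R, 0 <= t -> t <= e -> H (p + t *: ind S) >]]].

End TropicalPoints.

(* A metric tree in R^d / R(1,...,1), with the tropical Hilbert metric, together
   with the points at which its [n] blue and [d] red leaf edges are attached.
   The leaf edges have no length and are not part of [tpoints]. *)
Record leafed_tree (R : realType) (d n : nat) := LeafedTree {
  tpoints : 'cV[R]_d -> Prop;
  blue : 'I_n -> 'cV[R]_d;
  red : 'I_d -> 'cV[R]_d }.

Section Trees.
Variables (R : realType) (d n : nat).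
Implicit Types (T : leafed_tree R d n) (p : 'cV[R]_d).

(* At every point the primitive directions of the outgoing edges, plus [e_j] for
   each infinite ray attached there, sum to 0 modulo (1,...,1).  Points in the
   relative interior of a ray are balanced automatically. *)
Definition balanced T : Prop :=
  forall p, tpoints T p ->
    tequiv 0 (\sum_(S in germs (tpoints T) p) ind R S
              + \sum_(j | `[< tequiv (red T j) p >]) ind R [set j]).

Definition bicolored_tree_of (A : 'M[R]_(d, n)) T : Prop :=
  [/\ forall p, tpoints T p <-> tconv A p,
      forall i, tequiv (blue T i) (col i A),
      forall j, tpoints T (red T j)
    & balanced T].

Definition degree T p : nat :=
  (#|germs (tpoints T) p|
   + #|[set i : 'I_n | `[< tequiv (blue T i) p >]]|
   + #|[set j : 'I_d | `[< tequiv (red T j) p >]]|)%N.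

(* Points of degree 2 are not vertices, and the ends of the hull carry leaves. *)
Definition internal_vertex T p : Prop := tpoints T p /\ (3 <= degree T p)%N.

(* In a metric tree the path from [u] to [v] is the set of points [p] with
   d(u, p) + d(p, v) = d(u, v). *)
Definition on_path T (u v p : 'cV[R]_d) : Prop :=
  tpoints T p /\ hilbert u p + hilbert p v = hilbert u v.

Definition caterpillar T : Prop :=
  exists u v, [/\ tpoints T u, tpoints T v
    & forall p, internal_vertex T p -> on_path T u v p].

End Trees.

Section ColorSwap.
Variables (R : realType) (n : nat).
Implicit Types (T : leafed_tree R n n) (phi : 'cV[R]_n -> 'cV[R]_n).

(* An automorphism of the metric tree (a bijective isometry, on representatives)
   exchanging the red and the blue leaf with the same label. *)
Definition color_swap T phi : Prop :=
  [/\ forall x, tpoints T x -> tpoints T (phi x),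
      forall y, tpoints T y -> exists2 x, tpoints T x & tequiv (phi x) y,
      forall x y, tpoints T x -> tpoints T y ->
        hilbert (phi x) (phi y) = hilbert x y,
      forall i, tequiv (phi (blue T i)) (red T i)
    & forall i, tequiv (phi (red T i)) (blue T i)].

(* Points of a leaf edge other than its attachment point are never fixed, since
   leaf edges of distinct colors are exchanged. *)
Definition fixed_point T (x : 'cV[R]_n) : Prop :=
  tpoints T x /\ exists2 phi, color_swap T phi & tequiv (phi x) x.

Definition one_fixed_point T : Prop :=
  exists x, fixed_point T x /\ forall y, fixed_point T y -> tequiv x y.

End ColorSwap.

(* Main.v *)
Require Import Defs.
From mathcomp Require Import all_boot all_order perm all_algebra.
From mathcomp Require Import boolp reals.
From mathcomp Require Import fingroup lra.

(* Every column of [A] is an internal vertex of the tree: it carries a blue leaf,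
   the hull leaves it in some direction, and if there is only one such direction
   then balancing forces a red leaf there.  So in a caterpillar all columns lie on
   a Hilbert geodesic between two points of the hull, which turn out to be columns
   themselves, and the singularity of the 3 x 3 minors puts all columns on one
   tropical segment t |-> x + min(v, t), 0 <= t <= L.  Balancing locates red leaf j
   at t = v j; let blue leaf j be at t = s j.  Symmetry of [A] leaves two cases:
   s = v, where the identity swaps the colors and every point is fixed, and
   s = L - v, where a_ij = x_i + x_j + K + min(v_i + v_j - L, 0) is a symmetric
   factorization and the swap is the reflection of the segment. *)

Set Implicit Arguments.
Unset Strict Implicit.
Unset Printing Implicit Defensive.

Import Order.TTheory GRing.Theory Num.Theory.

Local Open Scope ring_scope.

Ltac lra_min :=
  intros; repeat match goal with H : context [Order.min _ _] |- _ => move: H end;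
  repeat match goal with |- context [Order.min ?a ?b] => case: (leP a b) => ? end; lra.

(** * Tropical singularity of minors and the symmetric tropical rank *)

Section Singularity.
Variable R : realType.

Lemma tweight_mxsub_perm k (M : 'M[R]_k) (p q s : 'S_k) :
  tweight (mxsub p q M) s = tweight M (p^-1 * s * q)%g.
Proof.
rewrite /tweight [RHS](reindex_inj (@perm_inj _ p)).
by apply: eq_bigr => i _; rewrite mxE !permM permK.
Qed.

Lemma tsingular_mxsub_perm k (M : 'M[R]_k) (p q : 'S_k) :
  tsingular (mxsub p q M) -> tsingular M.
Proof.
have minP s : tminimal (mxsub p q M) s -> tminimal M (p^-1 * s * q)%g.
  move/forallP=> s_min; apply/forallP=> t.
  by have := s_min (p * t * q^-1)%g; rewrite !tweight_mxsub_perm !mulgA mulVg mul1g mulgKV.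
move=> /existsP[s /existsP[t /and3P[st /minP s_min /minP t_min]]].
apply/existsP; exists (p^-1 * s * q)%g; apply/existsP; exists (p^-1 * t * q)%g.
apply/and3P; split=> //; apply: contraNneq st => /mulIg /mulgI ->//.
Qed.

(** Sending [i] to the number of [j] with [f j < f i] is a permutation because [f] is injective; its
    inverse sorts [f]. *)
Lemma injective_sort k n (f : 'I_k -> 'I_n) :
  injective f -> exists p : 'S_k, increasing [ffun i => f (p i)].
Proof.
move=> f_inj; pose below i := [set j | (f j < f i)%N].
have below_lt i : (#|below i| < k)%N.
  rewrite -[X in (_ < X)%N]card_ord -cardsT; apply: proper_card.
  by rewrite properT; apply/eqP=> /setP/(_ i); rewrite !inE ltnn.
have rank_inj : injective (fun i => Ordinal (below_lt i)).
  have mono i j : (f i < f j)%N -> (#|below i| < #|below j|)%N.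
    move=> fij; apply/proper_card/properP; split.
      by apply/subsetP=> h; rewrite !inE => /ltn_trans; apply.
    by exists i; rewrite !inE ?ltnn.
  move=> i j [] eq_ij; apply/f_inj/val_inj => /=.
  by case: (ltngtP (f i) (f j)) => // /mono; rewrite eq_ij ltnn.
exists (perm rank_inj)^-1%g; apply/forallP=> i; apply/forallP=> j; apply/implyP.
rewrite !ffunE -{1}[i](permKV (perm rank_inj)) -{1}[j](permKV (perm rank_inj)).
move: ((perm rank_inj)^-1%g i) ((perm rank_inj)^-1%g j) => {}i {}j; rewrite !permE /= ltnNge ltnNge.
apply: contra => fji; apply: subset_leq_card; apply/subsetP=> h; rewrite !inE.
by move=> /leq_trans; apply.
Qed.

(** Following a minimal permutation by the transposition of two equal columns keeps its weight. *)
Lemma tsingular_eq_col k (M : 'M[R]_k) (i j : 'I_k) :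
  i != j -> (forall h, M h i = M h j) -> tsingular M.
Proof.
move=> ij eqM.
have [s _ s_min] : exists2 s : 'S_k, true & forall t, tweight M s <= tweight M t.
  case: (arg_minP (tweight M) (i0 := 1%g : 'S_k) (P := xpredT)) => // s _ s_min.
  by exists s => // t; apply: s_min.
have wE : tweight M (s * tperm i j)%g = tweight M s.
  apply: eq_bigr => h _; rewrite permM.
  by case: tpermP => [->|->|_ _]; rewrite ?eqM.
apply/existsP; exists s; apply/existsP; exists (s * tperm i j)%g.
apply/and3P; split; last 2 first.
- exact/forallP.
- by apply/forallP=> t; rewrite wE.
apply/eqP=> /esym; rewrite -[RHS]mulg1 => /mulgI /permP/(_ i).
by rewrite tpermL perm1 => /esym/eqP; apply/negP.
Qed.

Lemma tsingular_trmx k (M : 'M[R]_k) : tsingular M^T -> tsingular M.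
Proof.
have wE s : tweight M^T s = tweight M s^-1%g.
  rewrite /tweight [RHS](reindex_inj (@perm_inj _ s)).
  by apply: eq_bigr => i _; rewrite mxE permK.
have minP s : tminimal M^T s -> tminimal M s^-1%g.
  by move/forallP=> s_min; apply/forallP=> t; have := s_min t^-1%g; rewrite !wE invgK.
move=> /existsP[s /existsP[t /and3P[st /minP s_min /minP t_min]]].
apply/existsP; exists s^-1%g; apply/existsP; exists t^-1%g.
by apply/and3P; split=> //; rewrite (inj_eq invg_inj).
Qed.

Lemma tsym_singular_tsingular k (M : 'M[R]_k) : tsym_singular M -> tsingular M.
Proof.
move=> /existsP[s /existsP[t /and3P[st s_min t_min]]].
apply/existsP; exists s; apply/existsP; exists t; apply/and3P; split=> //.
by apply: contraNneq st => ->.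
Qed.

Lemma increasing_inj k n (f : {ffun 'I_k -> 'I_n}) : increasing f -> injective f.
Proof.
move=> /forallP f_inc i j fij; apply/val_inj; case: (ltngtP i j) => //.
  by move=> ij; have := implyP (forallP (f_inc i) j) ij; rewrite fij ltnn.
by move=> ij; have := implyP (forallP (f_inc j) i) ij; rewrite fij ltnn.
Qed.

(** A repeated row or column already makes the minor singular. Otherwise sorting makes [f] and [g]
    increasing, where the rank bound applies; for principal minors it gives symmetric singularity,
    which is the stronger notion. *)
Lemma sym_tropical_rank_singular n (A : 'M[R]_n) k (f g : 'I_k -> 'I_n) :
  (sym_tropical_rank A < k)%N -> tsingular (mxsub f g A).
Proof.
move=> rank_lt; have non_sub : ~~ has_sym_nonsingular_sub A k.
  apply/negP=> Ak; have /existsP[f' /existsP[_ /and3P[/increasing_inj f_inj _ _]]] := Ak.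
  have k_le : (k < n.+1)%N by rewrite ltnS -[k]card_ord -[n]card_ord; apply: leq_card f_inj.
  have := @leq_bigmax_cond _ (fun h : 'I_n.+1 => has_sym_nonsingular_sub A h)
    (fun h => h : nat) (Ordinal k_le) Ak.
  by rewrite leqNgt rank_lt.
case: (boolP (injectiveb g)) => [/injectiveP g_inj|/injectivePn[i [j ij gij]]]; last first.
  by apply: (tsingular_eq_col ij) => h; rewrite !mxE gij.
case: (boolP (injectiveb f)) => [/injectiveP f_inj|/injectivePn[i [j ij fij]]]; last first.
  by apply/tsingular_trmx/(tsingular_eq_col ij) => h; rewrite !mxE fij.
have [p fp_inc] := injective_sort f_inj; have [q gq_inc] := injective_sort g_inj.
apply: (@tsingular_mxsub_perm _ _ p q).
have -> : mxsub p q (mxsub f g A) = mxsub [ffun i => f (p i)] [ffun i => g (q i)] A.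
  by apply/matrixP=> i j; rewrite !mxE !ffunE.
move: non_sub; rewrite negb_exists => /forallP/(_ [ffun i => f (p i)]).
rewrite negb_exists => /forallP/(_ [ffun i => g (q i)]).
rewrite fp_inc gq_inc /=; case: eqP => _; rewrite negbK //.
exact: tsym_singular_tsingular.
Qed.

Lemma sym_tropical_rank_attained n (A : 'M[R]_n) :
  (0 < sym_tropical_rank A)%N -> has_sym_nonsingular_sub A (sym_tropical_rank A).
Proof.
rewrite /sym_tropical_rank.
apply: (big_ind (fun m => (0 < m)%N -> has_sym_nonsingular_sub A m)) => //.
by move=> a b; rewrite /maxn; case: ifP.
Qed.

(** This is all that the lower bound on the rank contributes below; the upper bound enters through
    the singularity of 3 x 3 minors. *)
Lemma sym_tropical_rank2_nonflat n (A : 'M[R]_n) : sym_tropical_rank A = 2%N ->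
  exists i i' j j', A i j + A i' j' != A i j' + A i' j.
Proof.
move=> rankA; have := @sym_tropical_rank_attained n A; rewrite rankA => /(_ isT).
move=> /existsP[f /existsP[g /and3P[_ _ nonsing]]].
exists (f 0), (f 1), (g 0), (g 1); apply: contraTneq nonsing => flat.
pose t : 'S_2 := tperm 0 1.
have lift01 : lift ord0 ord0 = 1 :> 'I_2 by apply/val_inj.
have w1 : tweight (mxsub f g A) 1%g = A (f 0) (g 0) + A (f 1) (g 1).
  by rewrite /tweight !big_ord_recl big_ord0 addr0 !mxE !perm1 lift01.
have wt : tweight (mxsub f g A) t = A (f 0) (g 1) + A (f 1) (g 0).
  by rewrite /tweight !big_ord_recl big_ord0 addr0 !mxE lift01 tpermL tpermR.
have t_neq1 : 1%g != t.
  by apply/eqP=> /permP/(_ 0); rewrite perm1 tpermL => /(congr1 val).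
have S2 (s : 'S_2) : s = 1%g \/ s = t.
  have ord2 (i : 'I_2) : i = 0 \/ i = 1.
    by case: i => [[|[|i]] //= H]; [left|right]; apply/val_inj.
  have s01 : s 0 != s 1 by rewrite (inj_eq perm_inj).
  case: (ord2 (s 0)) s01 => e0; case: (ord2 (s 1)) => e1; rewrite e0 e1 // => _;
    [left|right]; apply/permP=> i; case: (ord2 i) => ->;
    by rewrite ?perm1 ?tpermL ?tpermR ?e0 ?e1.
have w_const s : tweight (mxsub f g A) s = A (f 0) (g 0) + A (f 1) (g 1).
  by case: (S2 s) => ->; rewrite ?w1 ?wt.
have all_min s : tminimal (mxsub f g A) s by apply/forallP=> s'; rewrite !w_const.
case: ifP => _; rewrite negbK; apply/existsP; exists 1%g; apply/existsP; exists t.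
  (* The two monomials differ in the exponent of the first diagonal variable: positive for the
     identity, 0 for the transposition. *)
  rewrite !all_min !andbT; apply/eqP=> /ffunP/(_ (0, 0)); rewrite !ffunE.
  have -> : [set l : 'I_2 | (if (l <= t l)%N then (l, t l) else (t l, l)) == (0, 0)] = set0.
    apply/setP=> l; rewrite !inE; apply/eqP.
    by case: tpermP => [->|->|] //; case: l => [[|[|l]] //= H] /eqP; rewrite -val_eqE.
  rewrite cards0; apply/eqP; rewrite -lt0n; apply/card_gt0P; exists 0.
  by rewrite inE perm1.
by rewrite all_min all_min t_neq1.
Qed.

(* Two distinct minimal permutations cannot both be the identity. *)
Lemma tsingular3_diag (M : 'M[R]_3) (i0 := 0 : 'I_3) (i1 := 1 : 'I_3) (i2 := ord_max : 'I_3) :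
  tsingular M ->
  [\/ M i0 i0 + M i1 i2 + M i2 i1 <= M i0 i0 + M i1 i1 + M i2 i2,
      M i0 i1 + M i1 i0 + M i2 i2 <= M i0 i0 + M i1 i1 + M i2 i2,
      M i0 i2 + M i1 i1 + M i2 i0 <= M i0 i0 + M i1 i1 + M i2 i2 |
      M i0 i1 + M i1 i2 + M i2 i0 <= M i0 i0 + M i1 i1 + M i2 i2 \/
      M i0 i2 + M i1 i0 + M i2 i1 <= M i0 i0 + M i1 i1 + M i2 i2].
Proof.
have wE s : tweight M s = M i0 (s i0) + M i1 (s i1) + M i2 (s i2).
  rewrite /tweight !big_ord_recl big_ord0 addr0 addrA.
  have -> : lift ord0 (lift ord0 ord0) = i2 by apply/val_inj.
  by have -> : lift ord0 ord0 = i1 by apply/val_inj.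
have ord3 (i : 'I_3) : [\/ i = i0, i = i1 | i = i2].
  by case: i => [[|[|[|i]]] //= H]; [constructor 1|constructor 2|constructor 3]; apply/val_inj.
move=> /existsP[s' /existsP[t' /and3P[st /forallP s_min /forallP t_min]]].
have [s s_neq1 s_le] : exists2 s : 'S_3, s != 1%g & tweight M s <= tweight M 1%g.
  case: (eqVneq s' 1%g) => [s1|s_neq1]; last by exists s'.
  by exists t' => //; rewrite -s1 eq_sym.
have n01 : s i0 != s i1 by rewrite (inj_eq perm_inj).
have n02 : s i0 != s i2 by rewrite (inj_eq perm_inj).
have n12 : s i1 != s i2 by rewrite (inj_eq perm_inj).
move: s_le; rewrite !wE !perm1.
have not1 : ~ [/\ s i0 = i0, s i1 = i1 & s i2 = i2].
  move=> [e0 e1 e2]; move/eqP: s_neq1; apply; apply/permP=> i; rewrite perm1.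
  by case: (ord3 i) => ->.
case: (ord3 (s i0)) n01 n02 not1 => ->; case: (ord3 (s i1)) n12 => ->;
  case: (ord3 (s i2)) => -> //= _ _ _ not1 ineq.
- by case: not1.
- by constructor 1.
- by constructor 2.
- by constructor 4; left.
- by constructor 4; right.
- by constructor 3.
Qed.

End Singularity.

(** * The Hilbert metric and tropical convex hulls *)

Section Hulls.
Variables (R : realType) (d : nat).
Implicit Types x y z : 'cV[R]_d.

Lemma tequivP x y : tequiv x y <-> exists c : R, forall i, y i 0 = x i 0 + c.
Proof.
split=> [[c ->]|[c yE]]; exists c; first by move=> i; rewrite !mxE.
by apply/colP=> i; rewrite !mxE yE.
Qed.

Lemma tequiv_refl x : tequiv x x.
Proof. by apply/tequivP; exists 0 => i; rewrite addr0. Qed.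

Lemma tequiv_sym x y : tequiv x y -> tequiv y x.
Proof. by move=> [c ->]; apply/tequivP; exists (- c) => i; rewrite !mxE addrK. Qed.

Lemma tequiv_trans x y z : tequiv x y -> tequiv y z -> tequiv x z.
Proof. by move=> [c ->] [c' ->]; apply/tequivP; exists (c + c') => i; rewrite !mxE addrA. Qed.

Lemma hilbert_ge x y i j : (x i 0 - y i 0) - (x j 0 - y j 0) <= hilbert x y.
Proof. by apply: le_trans (le_bigmax _ _ i); apply: (le_bigmax _ _ j). Qed.

Lemma hilbert_eq x y a b :
    (forall i, x b 0 - y b 0 <= x i 0 - y i 0 <= x a 0 - y a 0) ->
  hilbert x y = (x a 0 - y a 0) - (x b 0 - y b 0).
Proof.
(* The bound at [a] makes the right-hand side nonnegative, as the default value 0 of both maxima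
   requires. *)
move=> D_ab; apply/le_anti/andP; split; last exact: hilbert_ge.
have ab := D_ab a; apply: bigmax_le => [|i _]; first by lra.
apply: bigmax_le => [|j _]; first by lra.
by have := D_ab i; have := D_ab j; lra.
Qed.

Lemma hilbert_tequiv x y x' y' : tequiv x x' -> tequiv y y' -> hilbert x y = hilbert x' y'.
Proof.
move=> /tequivP[c x'E] /tequivP[c' y'E].
by apply: eq_bigr => i _; apply: eq_bigr => j _; rewrite !x'E !y'E; lra.
Qed.

Lemma exists_argmin (f : 'I_d -> R) : (0 < d)%N -> exists i, forall j, f i <= f j.
Proof.
move=> d_gt0; case: (arg_minP f (i0 := Ordinal d_gt0) (P := xpredT)) => // i _ i_min.
by exists i => j; apply: i_min.
Qed.

Lemma exists_argmax (f : 'I_d -> R) : (0 < d)%N -> exists i, forall j, f j <= f i.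
Proof.
move=> /(@exists_argmin (fun i => - f i))[i i_min].
by exists i => j; rewrite -lerN2.
Qed.

Lemma tconv_col n (A : 'M[R]_(d, n)) j : tconv A (col j A).
Proof.
(* The coefficient of a column [l] other than [j] is large enough that it nowhere drops below column
   [j]. *)
pose c l := if l == j then 0 else \sum_i `|A i j - A i l|.
exists (\col_l c l) => i k; rewrite mxE; split; [exists j|move=> l]; rewrite !mxE /c ?eqxx ?addr0 //.
case: eqP => [->|_]; first by rewrite addr0.
have := ler_norm (A i j - A i l); suff : `|A i j - A i l| <= \sum_i `|A i j - A i l| by lra.
by rewrite (bigD1 i) //= lerDl sumr_ge0.
Qed.

Lemma tconv_tequiv n (A : 'M[R]_(d, n)) x y : tequiv x y -> tconv A x -> tconv A y.
Proof.
move=> /tequivP[e yE] [c xE]; exists (c + const_mx e) => i j.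
rewrite (ord1 j) yE; have [[l <-] x_min] := xE i 0; split.
  by exists l; rewrite !mxE addrA.
by move=> h; rewrite !mxE; have := x_min h; lra.
Qed.

(** Combining two points tropically amounts to combining their coefficient vectors in the same
    way. *)
Lemma tconv_min n (A : 'M[R]_(d, n)) x y (e : R) :
  tconv A x -> tconv A y -> tconv A (\col_i Num.min (x i 0) (y i 0 + e)).
Proof.
move=> [c xE] [c' yE]; exists (\col_l Num.min (c l 0) (c' l 0 + e)) => i j.
rewrite (ord1 j) mxE; have [[l <-] x_min] := xE i 0; have [[l' <-] y_min] := yE i 0.
split; last first.
  by move=> h; rewrite mxE; have := x_min h; have := y_min h; lra_min.
have xl' := x_min l'; have yl := y_min l.
by case: (leP _ (_ + e)) => ?; [exists l|exists l']; rewrite mxE; lra_min.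
Qed.

(* The segment from [p] to [q] leaves [p] in the direction of the coordinates at
   which [q - p] is not minimal. *)
Lemma germs_neq0 n (A : 'M[R]_(d, n)) p q :
  tconv A p -> tconv A q -> ~ tequiv p q -> germs (tconv A) p != set0.
Proof.
move=> Ap Aq pq; have d_gt0 : (0 < d)%N.
  by rewrite lt0n; apply/eqP=> d0; apply: pq; exists 0; apply/colP=> i; have := ltn_ord i; rewrite {2}d0.
pose D i := q i 0 - p i 0; have [b b_min] := exists_argmin D d_gt0.
pose S := [set i | D b < D i]; apply/set0Pn; exists S; rewrite inE; apply/and3P; split.
- apply/set0Pn; apply: contrapT => S0; apply: pq; apply/tequivP; exists (D b) => i.
  suff : D i <= D b by have := b_min i; rewrite /D; lra.
  by rewrite leNgt; apply/negP=> Di; apply: S0; exists i; rewrite inE.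
- by apply/eqP=> /setP/(_ b); rewrite !inE ltxx.
(* [e] is the least positive excess of [D] over its minimum, capped at 1. *)
have [e e_gt0 e_le] : exists2 e, 0 < e & forall i, D b < D i -> e <= D i - D b.
  have [i i_min] := exists_argmin (fun i => if D b < D i then D i - D b else 1) d_gt0.
  exists (if D b < D i then D i - D b else 1); first by case: ifP; lra.
  by move=> j Dj; have := i_min j; rewrite Dj.
apply/asboolP; exists e => // t t_ge0 t_le.
(* This combination of [p] and [q] lowers by [t] exactly the coordinates where [D] is minimal;
   shifting by [t] then raises those in [S] instead. *)
apply: tconv_tequiv (tconv_min (- D b - t) Ap Aq).
apply/tequivP; exists t => i; rewrite !mxE inE.
have -> : q i 0 = p i 0 + D i by rewrite /D; lra.
have := b_min i; have := e_le i.
by case: (ltP (D b) (D i)) => Di; [move/(_ isT)|move=> _]; rewrite /= ?mulr1 ?mulr0; lra_min.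
Qed.

End Hulls.

(** * Matrices whose columns lie on one tropical segment *)

Section PathForm.
Variable R : realType.

(* The columns of [A] lie, up to a shift, on the tropical segment
   t |-> x + min(v, t), 0 <= t <= L, the [j]-th one at [t = s j]. *)
Record path_form d n (A : 'M[R]_(d, n)) (x v : 'I_d -> R) (w s : 'I_n -> R) (L : R)
    (a b : 'I_d) (k l : 'I_n) : Prop := PathForm {
  pf_entry : forall i j, A i j = x i + w j + Num.min (v i) (s j);
  pf_v : forall i, 0 <= v i <= L;
  pf_s : forall j, 0 <= s j <= L;
  pf_va : v a = 0;
  pf_vb : v b = L;
  pf_sk : s k = 0;
  pf_sl : s l = L;
  pf_L : 0 < L }.

Lemma geodesic_path_form d n (A : 'M[R]_(d, n)) (u z : 'cV[R]_d) :
    (forall f g, tsingular (mxsub f g A : 'M[R]_3)) ->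
    (exists i i' j j', A i j + A i' j' != A i j' + A i' j) ->
    tconv A u -> tconv A z ->
    (forall j, hilbert u (col j A) + hilbert (col j A) z = hilbert u z) ->
  exists x v w s L a b k l, path_form A x v w s L a b k l.
Proof.
move=> sing3 [i1 [i2 [j1 [j2 nonflat]]]] [cu uE] [cz zE] geo.
have d_gt0 : (0 < d)%N by apply: leq_ltn_trans (leq0n i1) (ltn_ord i1).
pose D i := z i 0 - u i 0; pose e j i := A i j - u i 0.
have [a a_min] := exists_argmin D d_gt0; have [b b_max] := exists_argmax D d_gt0.
have hil_uz : hilbert u z = D b - D a.
  rewrite (@hilbert_eq _ _ _ _ a b); first by rewrite /D; lra.
  by move=> i; have := a_min i; have := b_max i; rewrite /D; lra.
(* Additivity of the distances forces [e j] and [D - e j] to attain their extremes at the same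
   coordinates [a] and [b] as [D]. *)
have e_mono j i : e j a <= e j i <= e j b /\ D a - e j a <= D i - e j i <= D b - e j b.
  have := geo j; rewrite hil_uz.
  have := hilbert_ge u (col j A) a b; have := hilbert_ge (col j A) z a b.
  have := hilbert_ge u (col j A) i b; have := hilbert_ge (col j A) z i b.
  have := hilbert_ge u (col j A) a i; have := hilbert_ge (col j A) z a i.
  by rewrite !mxE /D /e => *; split; lra.
(* A column realizing [u] at coordinate [b] satisfies [e k b <= e k a], so by [e_mono] it equals [u]
   up to a shift. Likewise a column realizing [z] at [a] equals [z] up to a shift. *)
have [k ek] : exists k, forall i, e k i = e k a.
  have [[k k_b] _] := uE b 0; exists k => i.
  have [_ /(_ k)] := uE a 0; have := e_mono k i; move: k_b; rewrite /e => *; lra.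
have [l el] : exists l, forall i, e l i = e l a + (D i - D a).
  have [[l l_a] _] := zE a 0; exists l => i.
  have [_ /(_ l)] := zE b 0; have := e_mono l i; move: l_a; rewrite /e /D => *; lra.
(* The inequality from left to right is [e_mono]. For the converse take the minor with rows [a],
   [i], [b] and columns [l], [j], [k]: up to row and column shifts its diagonal term is
   [e j i - e j a], and singularity bounds it below by one of the other terms. *)
have e_min j i : e j i = e j a + Num.min (D i - D a) (e j b - e j a).
  pose f := [fun h : 'I_3 => if val h is 0%N then a else if val h is 1%N then i else b].
  pose g := [fun h : 'I_3 => if val h is 0%N then l else if val h is 1%N then j else k].
  have := tsingular3_diag (sing3 f g); rewrite !mxE /=.
  have [] := e_mono j i; have [] := e_mono j b.
  have := ek i; have := ek b; have := el i; have := el b; have := a_min i; have := b_max i.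
  by rewrite /e /D => ? ? ? ? ? ? ? ? ? ? [?|?|?|[?|?]]; lra_min.
have L_gt0 : 0 < D b - D a.
  rewrite subr_gt0 ltNge; apply/negP=> D_ba; case/eqP: nonflat.
  have flat i j : A i j = u i 0 + e j a.
    have := e_min j i; have := e_mono j b; have := a_min i; have := b_max i.
    by rewrite /e => *; lra_min.
  by rewrite !flat; lra.
exists (fun i => u i 0), (fun i => D i - D a), (fun j => e j a), (fun j => e j b - e j a).
exists (D b - D a), a, b, k, l; split=> //.
- by move=> i j; have := e_min j i; rewrite /e; lra.
- by move=> i; have := a_min i; have := b_max i; lra.
- by move=> j; have [] := e_mono j b; lra.
- by rewrite subrr.
- by rewrite ek subrr.
- by rewrite el; lra.
Qed.

(** Symmetry against the end columns [k] and [l] yields [row_k] and [v_diff]. The sign of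
    [v j - v k] is then the same for all [j], so [v k] is an extreme value of [v]: if 0, then
    [s = v]; if [L], then [s] is the reflection of [v]. *)
Lemma path_form_sym n (A : 'M[R]_n) x v w s L a b k l :
    A^T = A -> path_form A x v w s L a b k l ->
  (s =1 v) \/
  [/\ forall j, s j = L - v j &
      exists K, forall i j, A i j = x i + x j + K + Num.min (v i + v j - L) 0].
Proof.
move=> Asym [AE v_bd s_bd va vb sk sl L_gt0].
have sym i j : x i + w j + Num.min (v i) (s j) = x j + w i + Num.min (v j) (s i).
  by rewrite -!AE -[in LHS]Asym mxE.
have row_k j : w j - x j = w k - x k - Num.min (v k) (s j).
  by have := sym j k; rewrite sk; have := v_bd j; lra_min.
have v_diff j : v j - v k = Num.min (v l) (s j) - Num.min (v k) (s j).
  have := sym j l; rewrite sl; have := row_k j; have := row_k l; rewrite sl.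
  by have := v_bd j; have := v_bd k; lra_min.
have [kl|lk] := leP (v k) (v l); [left=> j|right].
  have vk : v k = 0 by have := v_diff a; have := v_bd k; lra_min.
  have vl : v l = L by have := v_diff b; have := v_bd l; have := s_bd b; lra_min.
  by have := v_diff j; have := s_bd j; rewrite vk vl; lra_min.
have vk : v k = L by have := v_diff b; have := v_bd k; lra_min.
have vl : v l = 0 by have := v_diff a; have := v_bd l; have := s_bd a; lra_min.
have sE j : s j = L - v j by have := v_diff j; have := s_bd j; rewrite vk vl; lra_min.
split=> //; exists (w k - x k) => i j; rewrite AE.
by have := row_k j; have := v_bd j; have := v_bd i; rewrite vk sE; lra_min.
Qed.

(** Each branch of the minimum splits evenly into a term in [i] and the same term in [j], giving one
    column of the factor. *)
Lemma clipped_sum_sym_factors n (A : 'M[R]_n) (x v : 'I_n -> R) L K :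
    (forall i j, A i j = x i + x j + K + Num.min (v i + v j - L) 0) ->
  sym_factors A 2.
Proof.
move=> AE; pose B := \matrix_(i < n, h < 2)
  if h == 0 then x i + K / 2 + v i - L / 2 else x i + K / 2.
exists B => i j; rewrite AE; split; last first.
  by move=> h; rewrite !mxE; case: ifP => _; lra_min.
have [?|?] := leP (v i + v j - L) 0; [exists 0|exists 1]; rewrite !mxE /=; lra.
Qed.

End PathForm.

(** * Edges, distances and balancing on a tropical segment *)

Lemma min_incr (R : realType) (v t t' : R) : t <= t' ->
  Num.min v t <= Num.min v t' <= Num.min v t + (t' - t).
Proof. lra_min. Qed.

(** The hypothesis keeps the breakpoint [v] at distance at least [e] from [t] unless it is [t]
    itself, so the minimum is affine on the interval of length [e] starting at [t]. *)
Lemma min_stepD (R : realType) (v t e r : R) :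
    [\/ v = t, v <= t - e | t + e <= v] -> 0 <= r <= e ->
  Num.min v (t + r) = Num.min v t + r * (t < v)%R%:R.
Proof. by case=> ? ?; case: (ltP t v) => ?; rewrite ?mulr1 ?mulr0; lra_min. Qed.

Lemma min_stepB (R : realType) (v t e r : R) :
    [\/ v = t, v <= t - e | t + e <= v] -> 0 <= r <= e ->
  Num.min v (t - r) = Num.min v t - r * (~~ (v < t)%R)%:R.
Proof. by case=> ? ?; case: (ltP v t) => ?; rewrite ?mulr1 ?mulr0; lra_min. Qed.

Lemma sum_ind1 (R : realType) d (P : pred 'I_d) i :
  (\sum_(j | P j) ind R [set j]) i 0 = (P i)%:R.
Proof.
rewrite summxE; case: (boolP (P i)) => Pi.
  rewrite (bigD1 i) //= mxE inE eqxx big1 ?addr0 // => j /andP[_ ji].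
  by rewrite mxE inE eq_sym (negbTE ji).
by rewrite big1 // => j Pj; rewrite mxE inE; case: eqP => // ij; rewrite ij Pj in Pi.
Qed.

Section Segment.
Variables (R : realType) (d : nat).
Implicit Types t : R.

Definition seg (x v : 'I_d -> R) (t : R) : 'cV[R]_d := \col_i (x i + Num.min (v i) t).

Variables (x v : 'I_d -> R) (L : R) (a b : 'I_d).
Hypotheses (v_bd : forall i, 0 <= v i <= L) (va : v a = 0) (vb : v b = L) (L_gt0 : 0 < L).

(** Coordinate [a] stays fixed and coordinate [b] moves at unit speed, so their difference recovers
    the parameter of a point known only up to a shift. *)
Lemma seg_ends t : 0 <= t <= L -> Num.min (v a) t = 0 /\ Num.min (v b) t = t.
Proof. by rewrite va vb => t_bd; split; lra_min. Qed.

Lemma seg_inj t t' :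
  0 <= t <= L -> 0 <= t' <= L -> tequiv (seg x v t) (seg x v t') -> t = t'.
Proof.
move=> /seg_ends[ta tb] /seg_ends[t'a t'b] /tequivP[c segE].
by have := segE a; have := segE b; rewrite !mxE ta tb t'a t'b; lra.
Qed.

Lemma hilbert_seg_le t t' : 0 <= t <= L -> 0 <= t' <= L -> t <= t' ->
  hilbert (seg x v t) (seg x v t') = t' - t /\ hilbert (seg x v t') (seg x v t) = t' - t.
Proof.
move=> /seg_ends[ta tb] /seg_ends[t'a t'b] tt'.
have [-> ->] : hilbert (seg x v t) (seg x v t') =
    (seg x v t a 0 - seg x v t' a 0) - (seg x v t b 0 - seg x v t' b 0) /\
  hilbert (seg x v t') (seg x v t) =
    (seg x v t' b 0 - seg x v t b 0) - (seg x v t' a 0 - seg x v t a 0).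
  by split; apply: hilbert_eq => i; rewrite !mxE ta tb t'a t'b; have := min_incr (v i) tt'; lra.
by rewrite !mxE ta tb t'a t'b; split; lra.
Qed.

Lemma hilbert_seg p q t t' : 0 <= t <= L -> 0 <= t' <= L ->
  tequiv (seg x v t) p -> tequiv (seg x v t') q -> hilbert p q = `|t - t'|.
Proof.
move=> t_bd t'_bd pE qE; rewrite -(hilbert_tequiv pE qE).
have [tt'|/ltW tt'] := leP t t'.
  by rewrite distrC ger0_norm ?subr_ge0 //; apply: (hilbert_seg_le t_bd t'_bd tt').1.
by rewrite ger0_norm ?subr_ge0 //; apply: (hilbert_seg_le t'_bd t_bd tt').2.
Qed.

Variable H : 'cV[R]_d -> Prop.
Hypothesis HE : forall p, H p <-> exists2 t : R, 0 <= t <= L & tequiv (seg x v t) p.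

(** The ends of the segment are covered by the distances to the values of [v], since 0 is [v a] and
    [L] is [v b]. *)
Lemma seg_step t : exists2 e, 0 < e &
  forall i, (v i = t \/ e <= `|v i - t|) /\ (t < L -> t + e <= L) /\ (0 < t -> e <= t).
Proof.
have d_gt0 : (0 < d)%N by apply: leq_ltn_trans (leq0n a) (ltn_ord a).
(* Where [v i = t], the value [L] is only a positive placeholder. *)
pose gap i := if v i == t then L else `|v i - t|.
have [i i_min] := exists_argmin gap d_gt0.
exists (gap i) => [|j]; first by rewrite /gap; case: eqP => // /eqP; rewrite -subr_eq0 normr_gt0.
have := i_min j; have := i_min a; have := i_min b; move: (gap i) => e.
rewrite /gap va vb => e_b e_a e_j; split; [|split=> t_bd].
- by case: (eqVneq (v j) t) e_j => [|_]; [left|right].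
- by move: e_b; rewrite gt_eqF // gtr0_norm ?subr_gt0 //; lra.
- by move: e_a; rewrite lt_eqF // ltr0_norm ?subr_lt0 //; lra.
Qed.

(** Moving forward raises the coordinates with [t < v i]. Moving backward lowers those with
    [t <= v i], which modulo constants raises those with [v i < t]. At an end of the segment one of
    the two sets is empty. *)
Lemma germs_seg p t : 0 <= t <= L -> tequiv (seg x v t) p ->
  germs H p = [set S in [set [set i | t < v i]; [set i | v i < t]] | S != set0].
Proof.
move=> t_bd /tequivP[c pE]; have [e e_gt0 e_step] := seg_step t.
have step i : [\/ v i = t, v i <= t - e | t + e <= v i].
  have [[|]] := e_step i; first by constructor 1.
  by case: (leP t (v i)) => ?; [rewrite ger0_norm ?subr_ge0 //|rewrite ltr0_norm ?subr_lt0 //] => *;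
    [constructor 3|constructor 2]; lra.
apply/setP=> S; rewrite !inE; apply/and3P/andP => [[Sn0 SnT /asboolP[e' e'_gt0 He']]|[S_eq Sn0]].
  split=> //; pose r := Num.min e e'.
  have r_gt0 : 0 < r by rewrite /r; lra_min.
  have r_le : r <= e' by rewrite /r; lra_min.
  have r_bd : 0 <= r <= e by rewrite /r; lra_min.
  have /HE[t' t'_bd /tequivP[c' segE]] : H (p + r *: ind R S) by apply: He'; lra.
  have bal i : Num.min (v i) t + c + r * (i \in S)%:R = Num.min (v i) t' + c'.
    by have := segE i; rewrite !mxE pE mxE; lra.
  have [ta tb] := seg_ends t_bd; have [t'a t'b] := seg_ends t'_bd.
  have c'E : c' = c + r * (a \in S)%:R by have := bal a; rewrite ta t'a; lra.
  have t'E : t' = t + r * (b \in S)%:R - r * (a \in S)%:R.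
    by have := bal b; rewrite tb t'b c'E; lra.
  move: t'_bd bal; rewrite {}t'E {}c'E {segE ta tb t'a t'b}.
  (* Membership of [a] and [b] in [S] decides the motion: both or neither means none, [a] alone
     means backward, [b] alone means forward. *)
  case: (a \in S); case: (b \in S); rewrite !(mulr1, mulr0, addr0, subr0) => t'_bd bal.
  - case/eqP: SnT; apply/setP=> i; rewrite inE; apply: contraTT isT => iS.
    by have := bal i; rewrite (negbTE iS) addrK mulr0; lra.
  - apply/orP; right; apply/eqP/setP=> i; rewrite inE; move/(_ i): bal.
    rewrite (min_stepB (step i) r_bd); case: (i \in S); case: (v i < t) => //=;
      rewrite ?mulr1 ?mulr0; lra.
  - apply/orP; left; apply/eqP/setP=> i; rewrite inE; move/(_ i): bal.
    rewrite (min_stepD (step i) r_bd); case: (i \in S); case: (t < v i) => //=;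
      rewrite ?mulr1 ?mulr0; lra.
  - case/set0Pn: Sn0 => i iS.
    by have := bal i; rewrite iS mulr1; lra.
split=> //.
  apply/eqP=> ST; case/orP: S_eq => /eqP S_eq; move: ST; rewrite S_eq => /setP.
    by move/(_ a); rewrite !inE va; lra.
  by move/(_ b); rewrite !inE vb; lra.
apply/asboolP; exists e => // r r_ge0 r_le; apply/HE.
have r_bd : 0 <= r <= e by rewrite r_ge0.
have /set0Pn[h hS] := Sn0; have [_ [tL t0]] := e_step a.
case/orP: S_eq => /eqP S_eq; move: hS; rewrite S_eq inE => h_t.
  have t_lt : t < L by have := v_bd h; lra.
  exists (t + r); first by have := tL t_lt; lra.
  apply/tequivP; exists c => i; rewrite !mxE pE mxE inE.
  by rewrite (min_stepD (step i) r_bd); lra.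
have t_gt : 0 < t by have := v_bd h; lra.
exists (t - r); first by have := t0 t_gt; lra.
apply/tequivP; exists (c + r) => i; rewrite !mxE pE mxE inE.
by rewrite (min_stepB (step i) r_bd); case: (v i < t); rewrite /= ?mulr1 ?mulr0; lra.
Qed.

Lemma sum_germs_seg p t i : 0 <= t <= L -> tequiv (seg x v t) p ->
  (\sum_(S in germs H p) ind R S) i 0 = (v i != t)%:R.
Proof.
move=> t_bd pE; rewrite (germs_seg t_bd pE).
pose up := [set i | t < v i]; pose down := [set i | v i < t].
have up_down : up != down.
  apply/eqP=> /setP eqS; have := eqS a; have := eqS b.
  case/andP: t_bd => t_ge0 t_le; rewrite !inE va vb [t < 0]ltNge [L < t]ltNge t_ge0 t_le /=.
  by move/negbT; rewrite -leNgt => Lt /esym/negbT; rewrite -leNgt => t0;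
    have := lt_le_trans L_gt0 (le_trans Lt t0); rewrite ltxx.
have -> : \sum_(S in [set S in [set up; down] | S != set0]) ind R S = ind R up + ind R down.
  rewrite (eq_bigl (fun S => (S \in [set up; down]) && (S != set0))); last by move=> S; rewrite inE.
  rewrite big_mkcondr big_setU1 ?inE //= big_set1.
  (* A missing direction is the empty set, whose indicator is 0, so the filter does not change the
     sum. *)
  have ind0 S : (if S != set0 then ind R S else 0) = ind R S :> 'cV_d.
    by case: eqP => // ->; apply/colP=> h; rewrite !mxE inE.
  by rewrite !ind0.
by rewrite !mxE !inE; case: (ltgtP t (v i)) => /= *; rewrite ?addr0 ?add0r.
Qed.

(** With red leaf [i] at parameter [r i], balancing at [t] makes [[v i != t] + [r i == t]]
    independent of [i]. Comparing [a] and [b] at [t = 0] gives [r a = 0]. At [t = r j] the value for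
    [a] is then 1, whereas [v j != r j] would give 2 for [j]. *)
Lemma balanced_red_seg n (T : leafed_tree R d n) :
    (forall p, tpoints T p <-> H p) -> (forall j, tpoints T (red T j)) -> balanced T ->
  forall j, tequiv (seg x v (v j)) (red T j).
Proof.
move=> TH redT balT.
have /choice[r red_seg] j : exists t : R, 0 <= t <= L /\ tequiv (seg x v t) (red T j).
  by have /TH /HE[t t_bd redE] := redT j; exists t.
have bal (t : R) : 0 <= t <= L -> exists c : R, forall i, (v i != t)%:R + (r i == t)%:R = c.
  move=> t_bd; have Hp : H (seg x v t) by apply/HE; exists t => //; apply: tequiv_refl.
  have [c /colP cE] := balT _ ((TH _).2 Hp); exists c => i.
  have := cE i; rewrite !mxE add0r; have -> : tpoints T = H by apply/funext=> p; apply/propext.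
  rewrite (sum_germs_seg _ t_bd (tequiv_refl _)) => <-; congr (_ + _).
  rewrite sum_ind1.
  have [r_bd r_red] := red_seg i; case: asboolP => red_t; case: eqP => // r_t.
    by case: r_t; apply: (seg_inj r_bd t_bd); apply: tequiv_trans red_t.
  by case: red_t; rewrite -r_t; apply: tequiv_sym.
have ra : r a = 0.
  have /bal[c cE] : 0 <= (0 : R) <= L by rewrite lexx ltW.
  have := cE a; have := cE b; rewrite va vb eqxx gt_eqF //.
  by case: (eqVneq (r a) 0) => // _; case: eqP => _ /=; lra.
move=> j; have [r_bd r_red] := red_seg j; suff -> : v j = r j by [].
apply/eqP; case: (eqVneq (v j) (r j)) => // vr; have [c cE] := bal _ r_bd.
have := cE a; have := cE j; rewrite va ra vr eqxx.
by case: (eqVneq 0 (r j)) => /= _; lra.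
Qed.

End Segment.

(** * The hull and the leaves of a matrix in path form *)

Lemma col_path_form (R : realType) d n (A : 'M[R]_(d, n)) x v w s L a b k l j :
  path_form A x v w s L a b k l -> tequiv (seg x v (s j)) (col j A).
Proof.
by move=> Apath; apply/tequivP; exists (w j) => i; rewrite !mxE (pf_entry Apath); lra.
Qed.

Lemma tconv_path_form (R : realType) d n (A : 'M[R]_(d, n)) x v w s L a b k l :
    path_form A x v w s L a b k l ->
  forall p, tconv A p <-> exists2 t : R, 0 <= t <= L & tequiv (seg x v t) p.
Proof.
move=> [AE v_bd s_bd _ _ sk sl L_gt0] p; split=> [[c pE]|[t t_bd]]; last first.
  (* Column [l] contributes [x + v] and column [k] contributes [x + t]; every other column stays at
     or above [x + t]. *)
  move/tconv_tequiv; apply; exists (\col_j (if j == l then - w l else t - w j)) => i h0.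
  have kl : k != l by apply/eqP=> kl; move: sk; rewrite kl sl; lra.
  have vi := v_bd i; split=> [|h].
    have [vt|tv] := leP (v i) t; [exists l|exists k]; rewrite !mxE AE ?eqxx ?(negbTE kl).
      by rewrite sl min_l ?min_l //; lra.
    by rewrite sk min_r ?min_r //; lra.
  rewrite !mxE AE; case: eqP => [->|_]; first by rewrite sl; lra_min.
  by have := s_bd h; lra_min.
have n_gt0 : (0 < n)%N by apply: leq_ltn_trans (leq0n k) (ltn_ord k).
(* With [m1] the minimum of [w + c] and [m2] that of [s + w + c], the combination is
   [x + min(v + m1, m2)], the segment point at [t = m2 - m1] shifted by [m1]. *)
have [l1 min1] := exists_argmin (fun j => w j + c j 0) n_gt0.
have [l2 min2] := exists_argmin (fun j => s j + (w j + c j 0)) n_gt0.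
exists (s l2 + (w l2 + c l2 0) - (w l1 + c l1 0)).
  by have := min1 l2; have := min2 l1; have := s_bd l1; have := s_bd l2; lra.
apply/tequivP; exists (w l1 + c l1 0) => i; rewrite mxE.
have [[h <-] p_min] := pE i 0; have := p_min l1; have := p_min l2.
by rewrite !AE; have := min1 h; have := min2 h; lra_min.
Qed.

Lemma path_form_red (R : realType) n (A : 'M[R]_n) x v w s L a b k l (T : leafed_tree R n n) :
    path_form A x v w s L a b k l -> bicolored_tree_of A T ->
  forall j, tequiv (seg x v (v j)) (red T j).
Proof.
move=> Apath [TA _ redT balT].
have [_ v_bd _ va vb _ _ L_gt0] := Apath.
exact: (balanced_red_seg v_bd va vb L_gt0 (tconv_path_form Apath) TA redT balT).
Qed.

(** * Symmetric factorizations of inner dimension 2 *)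

Lemma sym_factors2E (R : realType) n (A : 'M[R]_n) : sym_factors A 2 ->
  exists f g : 'I_n -> R, forall i j, A i j = Num.min (f i + f j) (g i + g j).
Proof.
move=> [B AE]; exists (fun i => B i 0), (fun i => B i 1) => i j.
have [[h <-] A_min] := AE i j; move: (A_min 0) (A_min 1) => {A_min}; rewrite !mxE.
have : h = 0 \/ h = 1.
  by case: h => [[|[|h]] //= H]; [left|right]; apply/val_inj.
by case=> -> *; [rewrite min_l|rewrite min_r].
Qed.

(** With indices ordered by [f - g], differences of two columns of [A] are monotone in the row.
    Hence every distance between columns is read off at the extreme rows [k] and [l], where it is
    additive. *)
Lemma sym_factors2_geodesic (R : realType) n (A : 'M[R]_n) : (0 < n)%N -> sym_factors A 2 ->
  exists k l, forall j,
    hilbert (col k A) (col j A) + hilbert (col j A) (col l A) = hilbert (col k A) (col l A).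
Proof.
move=> n_gt0 /sym_factors2E[f [g AE]].
have [l l_min] := exists_argmin (fun i => f i - g i) n_gt0.
have [k k_max] := exists_argmax (fun i => f i - g i) n_gt0.
have supermod i i' j j' : f i - g i <= f i' - g i' -> f j - g j <= f j' - g j' ->
    A i j + A i' j' <= A i' j + A i j'.
  by clear l_min k_max; rewrite !AE; lra_min.
have hilE j j' : f j' - g j' <= f j - g j ->
    hilbert (col j A) (col j' A) = (A l j - A l j') - (A k j - A k j').
  move=> jj'; rewrite (@hilbert_eq _ _ _ _ l k) ?mxE // => i; rewrite !mxE.
  by have := supermod _ _ _ _ (l_min i) jj'; have := supermod _ _ _ _ (k_max i) jj'; lra.
by exists k, l => j; rewrite !hilE //; lra.
Qed.

(** Doubling either branch of [A i j] bounds the left side. This excludes the case [s = v] of a path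
    form, where the end columns violate the inequality. *)
Lemma sym_factors2_minor (R : realType) n (A : 'M[R]_n) i j :
  sym_factors A 2 -> A i i + A j j <= A i j + A j i.
Proof. by move=> /sym_factors2E[f [g AE]]; rewrite !AE; lra_min. Qed.

(** Inner dimension 0 leaves no index attaining the minimum, and inner dimension 1 makes every 2 x 2
    minor flat. *)
Lemma sym_factors_nonflat (R : realType) n (A : 'M[R]_n) r :
    (exists i i' j j', A i j + A i' j' != A i j' + A i' j) ->
  sym_factors A r -> (2 <= r)%N.
Proof.
move=> [i [i' [j [j' nonflat]]]] [B AE]; case: r B AE => [|[|r]] // B AE.
  by have [[[]]] := AE i j.
case/eqP: nonflat; have entry h h' : A h h' = B h 0 + B h' 0.
  by have [[o <-] _] := AE h h'; rewrite mxE (ord1 o).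
by rewrite !entry; lra.
Qed.

(** * Columns as vertices of the tree, and the two implications *)

Lemma internal_vertex_col (R : realType) d n (A : 'M[R]_(d, n)) (T : leafed_tree R d n) j :
    (exists i i' j j', A i j + A i' j' != A i j' + A i' j) ->
  bicolored_tree_of A T -> internal_vertex T (col j A).
Proof.
move=> nonflat [TA blueT _ balT].
have TE : tpoints T = tconv A by apply/funext=> p; apply/propext.
have Tj : tpoints T (col j A) by rewrite TE; apply: tconv_col.
split=> //.
have germs_gt0 : (0 < #|germs (tpoints T) (col j A)|)%N.
  rewrite TE card_gt0; have [j' jj'] : exists j', ~ tequiv (col j A) (col j' A).
    apply: contrapT => all_eq; case: nonflat => i [i' [h [h' /eqP[]]]].
    have [y yE] : exists y, forall i, A i j = y i by exists (A^~ j).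
    have /choice[c cE] h'' : exists c, forall i, A i h'' = y i + c.
      have : tequiv (col j A) (col h'' A) by apply: contrapT => ?; apply: all_eq; exists h''.
      by move=> /tequivP[c cE]; exists c => i''; have := cE i''; rewrite !mxE yE.
    by rewrite !cE; lra.
  exact: (germs_neq0 (tconv_col A j) (tconv_col A j') jj').
have blue_gt0 : (0 < #|[set i | `[< tequiv (blue T i) (col j A) >]]|)%N.
  by rewrite card_gt0; apply/set0Pn; exists j; rewrite inE; apply/asboolP.
rewrite /degree; have [germs_gt1|germs_le1] := ltnP 1 #|germs (tpoints T) (col j A)|.
  by rewrite (leq_trans _ (leq_addr _ _)) // -[3%N]/(2 + 1)%N leq_add.
suff red_gt0 : (0 < #|[set j' | `[< tequiv (red T j') (col j A) >]]|)%N.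
  by rewrite -[3%N]/(1 + 1 + 1)%N !leq_add.
rewrite card_gt0; apply/eqP=> red0.
have /cards1P[S germsE] : #|germs (tpoints T) (col j A)| == 1%N.
  by rewrite eqn_leq germs_le1 germs_gt0.
(* With one outgoing direction [S] and no red leaf, balancing makes the indicator of [S] constant,
   but [S] is neither empty nor full. *)
have := balT _ Tj; rewrite germsE big_set1 [X in _ + X]big_pred0 ?addr0; last first.
  by move=> h; have /setP/(_ h) := red0; rewrite !inE.
move=> /tequivP[c indE].
have : S \in germs (tpoints T) (col j A) by rewrite germsE inE.
rewrite inE => /and3P[/set0Pn[i iS] /eqP SnT _]; apply: SnT; apply/setP=> i'; rewrite inE.
by have := indE i; have := indE i'; rewrite !mxE iS; case: (i' \in S) => //=; lra.
Qed.

Lemma sym_factors2_tree (R : realType) (n : nat) (A : 'M[R]_n) (T : leafed_tree R n n) :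
    A^T = A -> sym_tropical_rank A = 2%N -> bicolored_tree_of A T -> sym_factors A 2 ->
  caterpillar T /\ one_fixed_point T.
Proof.
move=> Asym rankA TA fact; have nonflat := sym_tropical_rank2_nonflat rankA.
have n_gt0 : (0 < n)%N by case: nonflat => i _; apply: leq_ltn_trans (leq0n i) (ltn_ord i).
have [k0 [l0 geo]] := sym_factors2_geodesic n_gt0 fact.
have sing3 f g : tsingular (mxsub f g A : 'M[R]_3).
  by apply: sym_tropical_rank_singular; rewrite rankA.
have [x [v [w [s [L [a [b [k [l Apath]]]]]]]]] :=
  geodesic_path_form sing3 nonflat (tconv_col A k0) (tconv_col A l0) geo.
have [AE v_bd s_bd va vb sk sl L_gt0] := Apath.
have sE j : s j = L - v j.
  case: (path_form_sym Asym Apath) => [sv|[sE _]]; last exact: sE.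
  have := sym_factors2_minor k l fact.
  by rewrite !AE -!sv sk sl; lra_min.
have blue_seg j : tequiv (seg x v (L - v j)) (blue T j).
  rewrite -sE; have [_ blueT _ _] := TA.
  exact: tequiv_trans (col_path_form _ Apath) (tequiv_sym (blueT j)).
have red_seg := path_form_red Apath TA.
have TE p : tpoints T p <-> exists2 t : R, 0 <= t <= L & tequiv (seg x v t) p.
  by have [TE _ _ _] := TA; split=> [/TE/(tconv_path_form Apath)//|/(tconv_path_form Apath)/TE].
have Tseg (t : R) : 0 <= t <= L -> tpoints T (seg x v t).
  by move=> t_bd; apply/TE; exists t => //; apply: tequiv_refl.
have dist := @hilbert_seg _ _ x v L a b va vb.
split.
  have L0 : 0 <= (0 : R) <= L by lra.
  have LL : 0 <= L <= L by lra.
  exists (seg x v 0), (seg x v L); split; [exact: Tseg|exact: Tseg|].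
  move=> p [Tp _]; split=> //; have /TE[t t_bd pE] := Tp.
  rewrite (dist _ _ _ _ L0 t_bd (tequiv_refl _) pE) (dist _ _ _ _ t_bd LL pE (tequiv_refl _)).
  rewrite (dist _ _ _ _ L0 LL (tequiv_refl _) (tequiv_refl _)).
  by rewrite !ler0_norm; lra.
(* The reflection of the segment; the inner difference of coordinates [b] and [a] is the parameter
   of [p]. *)
pose phi (p : 'cV[R]_n) := seg x v (L - ((p b 0 - x b) - (p a 0 - x a))).
have phiE (t : R) p : 0 <= t <= L -> tequiv (seg x v t) p -> phi p = seg x v (L - t).
  move=> t_bd /tequivP[c pE]; rewrite /phi !pE !mxE.
  have [-> ->] := seg_ends va vb t_bd; congr (seg x v _); lra.
have reflect_bd (t : R) : 0 <= t <= L -> 0 <= L - t <= L by lra.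
have half_bd : 0 <= L / 2 <= L by lra.
exists (seg x v (L / 2)); split.
  split; first exact: Tseg.
  exists phi; last by rewrite (phiE _ _ half_bd (tequiv_refl _)) (_ : L - L / 2 = L / 2);
    [apply: tequiv_refl|lra].
  split.
  - by move=> p /TE[t t_bd pE]; rewrite (phiE _ _ t_bd pE); apply/Tseg/reflect_bd.
  - move=> p /TE[t t_bd pE]; exists (seg x v (L - t)); first exact/Tseg/reflect_bd.
    by rewrite (phiE _ _ (reflect_bd _ t_bd) (tequiv_refl _)) subKr.
  - move=> p q /TE[t t_bd pE] /TE[t' t'_bd qE].
    rewrite (phiE _ _ t_bd pE) (phiE _ _ t'_bd qE) (dist _ _ _ _ t_bd t'_bd pE qE).
    rewrite (dist _ _ _ _ (reflect_bd _ t_bd) (reflect_bd _ t'_bd) (tequiv_refl _) (tequiv_refl _)).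
    by rewrite -normrN; congr `|_|; lra.
  - by move=> j; rewrite (phiE _ _ (reflect_bd _ (v_bd j)) (blue_seg j)) subKr.
  - by move=> j; rewrite (phiE _ _ (v_bd j) (red_seg j)).
(* An arbitrary swap [psi] carries blue leaf [a], at parameter [L], to red leaf [a], at 0. A point
   it fixes is equidistant from both ends, hence the midpoint. *)
move=> p [Tp [psi [_ _ psi_iso psi_blue _] psi_p]].
have /TE[t t_bd pE] := Tp.
have Tblue : tpoints T (blue T a) by apply/TE; exists (L - v a) => //; apply/reflect_bd.
have := psi_iso _ _ Tblue Tp.
rewrite (hilbert_tequiv (psi_blue a) psi_p) (dist _ _ _ _ (v_bd a) t_bd (red_seg a) pE).
rewrite (dist _ _ _ _ (reflect_bd _ (v_bd a)) t_bd (blue_seg a) pE) va.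
rewrite ler0_norm ?ger0_norm; [|lra..] => tE.
by rewrite (_ : L / 2 = t); [|lra].
Qed.

Lemma caterpillar_sym_factors2 (R : realType) (n : nat) (A : 'M[R]_n) (T : leafed_tree R n n) :
    A^T = A -> sym_tropical_rank A = 2%N -> bicolored_tree_of A T ->
  caterpillar T -> one_fixed_point T -> sym_factors A 2.
Proof.
move=> Asym rankA TA [u [z [Tu Tz cat]]] [p0 [_ fix_p0]].
have nonflat := sym_tropical_rank2_nonflat rankA.
have sing3 f g : tsingular (mxsub f g A : 'M[R]_3).
  by apply: sym_tropical_rank_singular; rewrite rankA.
have [TE blueT _ _] := TA.
have geo j : hilbert u (col j A) + hilbert (col j A) z = hilbert u z.
  by have [] := cat _ (internal_vertex_col j nonflat TA).
have [x [v [w [s [L [a [b [k [l Apath]]]]]]]]] :=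
  geodesic_path_form sing3 nonflat ((TE u).1 Tu) ((TE z).1 Tz) geo.
case: (path_form_sym Asym Apath) => [sv|[_ [K AE]]]; last exact: clipped_sum_sym_factors AE.
(* If [s = v], the identity is a color swap, and uniqueness of the fixed point would identify the
   two ends of a segment of positive length. *)
exfalso; have [_ v_bd s_bd va vb sk sl L_gt0] := Apath.
have blue_red j : tequiv (blue T j) (red T j).
  apply: tequiv_trans (blueT j) _; apply: tequiv_trans (tequiv_sym (col_path_form j Apath)) _.
  by rewrite sv; apply: path_form_red Apath TA j.
have all_fixed p : tpoints T p -> tequiv p0 p.
  move=> Tp; apply: fix_p0; split=> //; exists id; last exact: tequiv_refl.
  split=> //; first by move=> y Ty; exists y => //; apply: tequiv_refl.
  by move=> j; apply: tequiv_sym.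
have p0_seg (t : R) : 0 <= t <= L -> tequiv p0 (seg x v t).
  move=> t_bd; apply/all_fixed/TE/(tconv_path_form Apath).
  by exists t => //; apply: tequiv_refl.
have L0 : 0 <= (0 : R) <= L by lra.
have LL : 0 <= L <= L by lra.
have := seg_inj va vb L0 LL (tequiv_trans (tequiv_sym (p0_seg _ L0)) (p0_seg _ LL)).
lra.
Qed.

Theorem corollary3p7 (R : realType) (n : nat) (A : 'M[R]_n)
    (Asym : A^T = A) (Arank : sym_tropical_rank A = 2%N)
    (T : leafed_tree R n n) (TA : bicolored_tree_of A T) :
  is_sym_barvinok_rank A 2 <-> caterpillar T /\ one_fixed_point T.
Proof.
split=> [[fact _]|[cat fix1]]; first exact: sym_factors2_tree TA fact.
split; first exact: caterpillar_sym_factors2 cat fix1.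
by move=> r; apply/sym_factors_nonflat/sym_tropical_rank2_nonflat.
Qed.
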